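(* Let $\mathcal{A}\subseteq\mathbb{N}$ be an infinite set of integers with positive lower density, and assume that for all $\alpha\in BAD$ the sequence $(n\alpha)_{n\in\mathcal{A}}$ (with $\mathcal{A}$ enumerated in increasing order) is uniformly distributed modulo $1$. Then $$\bigcap_{\psi\in\mathcal{M}_{\mathcal{A}}}\mathcal{K}_{\mathcal{A}}(\psi)=BAD.$$
   Context: $\mathbb{N}$ is the set of positive integers, $\lVert x\rVert$ the distance from $x$ to the nearest integer, $\lambda$ the Lebesgue measure; ''monotonically decreasing'' means non-increasing. $\mathcal{A}$ has positive lower density if $\liminf_{N\to\infty}\frac{\#\{n\le N:n\in\mathcal{A}\}}{N}>0$. $BAD:=\{\alpha\in[0,1):\liminf_{n\to\infty}n\lVert n\alpha\rVert>0\}$. $\mathcal{M}_{\mathcal{A}}:=\{\psi:\mathbb{N}\to[0,\infty)\text{ monotonically decreasing},\ \sum_{n\in\mathcal{A}}\psi(n)=\infty\}$. For $\psi:\mathbb{N}\to[0,\infty)$ and $\alpha\in\mathbb{R}$, $T_{\mathcal{A}}(\psi,\alpha):=\{\gamma\in[0,1):\lVert n\alpha+\gamma\rVert\le\psi(n)\text{ for infinitely many }n\in\mathcal{A}\}$, and $\mathcal{K}_{\mathcal{A}}(\psi):=\{\alpha\in[0,1):\lambda(T_{\mathcal{A}}(\psi,\alpha))=1\}$. *)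

(* Defs.v *)
From HB Require Import structures.
From mathcomp Require Export all_boot all_order all_algebra.
From mathcomp Require Export all_classical all_reals all_analysis.
Export Order.TTheory GRing.Theory Num.Theory.
Export numFieldNormedType.Exports.

Set Implicit Arguments.
Unset Strict Implicit.
Unset Printing Implicit Defensive.

Local Open Scope classical_set_scope.
Local Open Scope ring_scope.

(* Subsets of the positive integers are sets A : set nat with A `<=` posnat.
   Functions on the positive integers are functions on nat whose value at 0
   is irrelevant: every condition on them below ignores it. *)
Definition posnat : set nat := [set n | (0 < n)%N].

Definition dist_int (R : realType) (x : R) : R :=
  inf [set `|x - m%:~R| | m in [set: int]].

Definition frac_part (R : realType) (x : R) : R := x - (Num.floor x)%:~R.

Definition lower_density (R : realType) (A : set nat) : \bar R :=
  limn_einf (fun N : nat =>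
    ((count (fun n => n \in A) (iota 1 N))%:R / N%:R : R)%:E).

Definition increasing_enum (A : set nat) (a : nat -> nat) : Prop :=
  {homo a : i j / (i < j)%N} /\ range a = A.

Definition unif_distr_mod1 (R : realType) (x : nat -> R) : Prop :=
  forall s t : R, 0 <= s -> s < t -> t <= 1 ->
    (fun N : nat =>
      (count (fun k => s <= frac_part (x k) < t) (iota 0 N))%:R / N%:R : R)
      @ \oo --> t - s.

Definition BAD (R : realType) : set R :=
  [set alpha | 0 <= alpha < 1 /\
    (0 < limn_einf (fun n : nat =>
           (n%:R * dist_int (n%:R * alpha))%:E))%E].

Arguments BAD R : clear implicits.

Definition calM (R : realType) (A : set nat) : set (nat -> R) :=
  [set psi | [/\ forall n, (0 < n)%N -> 0 <= psi n,
                 forall m n, (0 < m)%N -> (m <= n)%N -> psi n <= psi m &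
                 (\sum_(0 <= n <oo | n \in A) (psi n)%:E = +oo)%E]].

Definition calT (R : realType) (A : set nat) (psi : nat -> R) (alpha : R) :
    set R :=
  [set gamma | 0 <= gamma < 1 /\
    infinite_set
      [set n | A n /\ dist_int (n%:R * alpha + gamma) <= psi n]].

Definition calK (R : realType) (A : set nat) (psi : nat -> R) : set R :=
  [set alpha | 0 <= alpha < 1 /\
    lebesgue_measure (calT A psi alpha) = 1%E].

(* Main.v *)
Require Import Defs.
From mathcomp Require Import ring lra zify measurable_realfun.

(** Both inclusions come from the way the points n alpha, n in A, spread over the
   circle; gamma belongs to calT A psi alpha when infinitely many of the balls of
   centre - n alpha and radius psi n, n in A, contain it modulo 1.

   If alpha is not badly approximable, there are q for which q ||q alpha|| is
   tiny. The multiples n alpha with n <= q K then cluster around q points, so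
   that a function psi constant on a long block of indices covers a small part
   of the circle, while its sum over the part of A in the block stays bounded
   below because A has positive density. Concatenating such blocks gives
   a psi in calM for which calT has measure less than 1 (not_bad_witness).

   If alpha is badly approximable, the first N multiples of alpha are c / N
   separated (bad_uniform, frac_part_separated). Fix an interval, and scan the
   balls whose centres lie in its middle half, keeping a ball when it is disjoint
   from those kept before. As long as the kept balls occupy only a small
   proportion of the interval, separation shows that they obstruct few of the
   later centres, whereas equidistribution along A supplies many of them; so
   each block ]M, L M] contributes at least a constant times L M r (L M), where
   the radii r n = min (psi n, eta / n) are kept below the separation, and Cauchy
   condensation makes the kept length diverge, which is absurd
   (dyadic_truncation_diverges, greedy_sum_large). Hence the kept balls fill a
   proportion of the interval that does not depend on it (far_from_thin). The set
   of gamma that avoid all balls from some rank on therefore has no density point, and is null by the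
   Lebesgue density theorem (no_density_point_null). Because the kept balls are
   disjoint, their measures simply add up, and no estimate of the measure of
   intersections is needed. *)

Set Implicit Arguments.
Unset Strict Implicit.
Unset Printing Implicit Defensive.

Local Open Scope classical_set_scope.
Local Open Scope ring_scope.

(** * Distance to the nearest integer *)

Section DistInt.
Variable R : realType.
Implicit Types (x y d : R) (m : int) (n : nat).

Lemma dist_int_le x m : dist_int x <= `|x - m%:~R|.
Proof.
apply: ge_inf; last by exists m.
by exists 0 => _ [k _ <-]; exact: normr_ge0.
Qed.

Lemma le_dist_int x d : (forall m, d <= `|x - m%:~R|) -> d <= dist_int x.
Proof.
move=> dP; apply: lb_le_inf; first by exists `|x - 0%:~R|, 0.
by move=> _ [m _ <-]; exact: dP.
Qed.

Lemma dist_int_ge0 x : 0 <= dist_int x.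
Proof. by apply: le_dist_int => m; exact: normr_ge0. Qed.

(** Attainment turns closeness to the integers into closeness to one explicit
   integer, which is what the covering by intervals below needs. *)
Lemma dist_int_attained x : exists m, dist_int x = `|x - m%:~R|.
Proof.
have /andP[fl fu] := floor_itv x; set f := Num.floor x in fl fu.
rewrite intrD in fu.
(* The nearest integer is one of the two integers surrounding x. *)
have near k : (`|x - f%:~R| <= `|x - k%:~R|) || (`|x - (f + 1)%:~R| <= `|x - k%:~R|).
  case: (leP k f) => kf.
    have : (k%:~R : R) <= f%:~R by rewrite ler_int.
    by move=> h; apply/orP; left; rewrite !ger0_norm; lra.
  have : ((f + 1)%:~R : R) <= k%:~R by rewrite ler_int; lia.
  rewrite intrD => h; apply/orP; right.
  by rewrite !ler0_norm; lra.
case: (leP `|x - f%:~R| `|x - (f + 1)%:~R|) => h; [exists f|exists (f + 1)];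
  apply/eqP; rewrite eq_le dist_int_le /=; apply: le_dist_int => k.
  by case/orP: (near k) => // /(le_trans h).
by case/orP: (near k) => // /(le_trans (ltW h)).
Qed.

Lemma dist_int_triangle x y : dist_int (x + y) <= dist_int x + dist_int y.
Proof.
have [m ->] := dist_int_attained x; have [k ->] := dist_int_attained y.
apply: (le_trans (dist_int_le _ (m + k))); rewrite intrD.
by rewrite opprD addrACA; exact: ler_normD.
Qed.

Lemma dist_int_le_norm x : dist_int x <= `|x|.
Proof. by have := dist_int_le x 0; rewrite subr0. Qed.

Lemma dist_intN x : dist_int (- x) = dist_int x.
Proof.
have le (y : R) : dist_int (- y) <= dist_int y.
  have [m ->] := dist_int_attained y.
  apply: (le_trans (dist_int_le _ (- m))).
  by rewrite intrN -opprD normrN.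
by apply/eqP; rewrite eq_le le -{1}(opprK x) le.
Qed.

Lemma dist_int_mulrn x n : dist_int (n%:R * x) <= n%:R * dist_int x.
Proof.
elim: n => [|n IH]; first by rewrite !mul0r (le_trans (dist_int_le_norm _))// normr0.
rewrite -natr1 !mulrDl !mul1r (le_trans (dist_int_triangle _ _))//.
by rewrite lerD2r.
Qed.

Lemma dist_int_lip x y : `|dist_int x - dist_int y| <= `|x - y|.
Proof.
have le (u v : R) : dist_int u - dist_int v <= `|u - v|.
  rewrite lerBlDr; have := dist_int_triangle (u - v) v; rewrite subrK.
  by move=> /le_trans; apply; rewrite lerD2r dist_int_le_norm.
by rewrite ler_norml lerNl opprB le andbT distrC le.
Qed.

Lemma continuous_dist_int : continuous (@dist_int R).
Proof.
move=> x; apply/(@cvgrPdist_le _ R) => e e0; near=> y.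
apply: (le_trans (dist_int_lip _ _)).
near: y; apply: (@cvgr_dist_le _ R); [exact: cvg_id|by []].
Unshelve. all: by end_near. Qed.

Lemma measurable_close x d : measurable [set g : R | dist_int (x + g) <= d].
Proof.
have -> : [set g : R | dist_int (x + g) <= d] =
    (fun g => dist_int (x + g)) @^-1` `]-oo, d].
  by apply/seteqP; split=> g /=; rewrite in_itv.
rewrite -[X in measurable X]setTI; apply: continuous_measurable_fun => //.
move=> y; apply: (@continuous_comp R R R (fun g => x + g) (@dist_int R)).
  by apply: cvgD; [exact: cvg_cst|exact: cvg_id].
exact: continuous_dist_int.
Qed.

(** For g in [0, 1), an integer within d < 1 of x + g is floor x, floor x + 1 or
   floor x + 2, so three intervals of length 2 d cover the set. *)
Lemma close_measure_le x d : 0 <= d -> d < 1 ->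
  (lebesgue_measure [set g : R | (0 <= g < 1 /\ dist_int (x + g) <= d)%R]
     <= (6 * d)%:E)%E.
Proof.
move=> d0 d1; set f : R := (Num.floor x)%:~R.
pose I (i : R) := `[f + i - x - d, f + i - x + d]%classic : set R.
have mI i : measurable (I i) by exact: measurable_itv.
have muI i : (lebesgue_measure (I i) <= (2 * d)%:E)%E.
  rewrite lebesgue_measure_itv/= lte_fin; case: ltP => h; last first.
    by rewrite lee_fin; lra.
  by rewrite -EFinD lee_fin; lra.
apply: (@le_trans _ _ (lebesgue_measure (I 0 `|` I 1 `|` I 2 : set R))).
  apply: le_outer_measure => g /= [/andP[g0 g1]].
  have [m ->] := dist_int_attained (x + g) => hm.
  have := hm; rewrite ler_norml => /andP[h1 h2].
  have /andP[] := floor_itv x; rewrite intrD -/f => fx xf.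
  have mf : Num.floor x <= m.
    rewrite -ltzD1 -(@ltr_int R) intrD; rewrite -/f; lra.
  have fm : m <= Num.floor x + 2.
    rewrite -ltzD1 -(@ltr_int R) !intrD; rewrite -/f; lra.
  have : (m == Num.floor x) || (m == Num.floor x + 1) || (m == Num.floor x + 2) by lia.
  case/orP => [/orP[]|] /eqP em; move: h1 h2; rewrite em ?intrD -/f => h1 h2.
  - by left; left; rewrite /I/= in_itv/=; apply/andP; split; lra.
  - by left; right; rewrite /I/= in_itv/=; apply/andP; split; lra.
  - by right; rewrite /I/= in_itv/=; apply/andP; split; lra.
apply: (le_trans (measureU2 _ _ _)).
- by apply: measurableU; exact: mI.
- exact: mI.
apply: (@le_trans _ _ ((2 * d)%:E + (2 * d)%:E + (2 * d)%:E)%E).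
  apply: leeD.
    apply: (le_trans (measureU2 _ _ _)); [exact: mI|exact: mI|].
    by apply: leeD; exact: muI.
  exact: muI.
by rewrite -!EFinD lee_fin; lra.
Qed.

End DistInt.

(** * Positive lower limits, and the complement of calT *)

(** Both the density of A and bad approximability are positive lower limits;
   they enter only through an explicit constant valid from some rank on. *)
Lemma limn_einf_gt0P (R : realType) (u : nat -> R) :
  (0 < limn_einf (fun n => (u n)%:E))%E <->
  exists2 c, 0 < c & exists N, forall n, (N <= n)%N -> c <= u n.
Proof.
rewrite limn_einf_lim (cvg_lim _ (@cvg_einfs_sup _ _))//; split.
  move=> /ereal_sup_gt[_ [N _ <-]] uN.
  have le_u n : (N <= n)%N -> (einfs (fun n => (u n)%:E) N <= (u n)%:E)%E.
    by move=> Nn; apply: ereal_inf_lbound; exists n.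
  case: (einfs _ N) uN le_u => [r| |] //= r0 le_u; [exists r|exists 1] => //.
    by exists N => n /le_u; rewrite lee_fin.
  by exists N => n /le_u; rewrite leye_eq.
move=> [c c0 [N cP]]; apply: (@lt_le_trans _ _ c%:E); first by rewrite lte_fin.
apply: (@le_trans _ _ (einfs (fun n => (u n)%:E) N)).
  by apply: le_ereal_inf_tmp => _ [n Nn <-]; rewrite lee_fin cP.
by apply: ereal_sup_ubound; exists N.
Qed.

(** These increase with N, and their union meets [0, 1) in the complement of
   calT, so that full measure of calT amounts to each of them being null in
   [0, 1). *)
Definition far_from (R : realType) (A : set nat) (psi : nat -> R) (alpha : R)
    (N : nat) : set R :=
  [set g | forall n, A n -> (N <= n)%N -> psi n < dist_int (n%:R * alpha + g)].

Section Measurability.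
Variables (R : realType) (A : set nat) (psi : nat -> R) (alpha : R).

Lemma measurable_far_from N : measurable (far_from A psi alpha N).
Proof.
have -> : far_from A psi alpha N =
    \bigcap_n (if `[< A n /\ (N <= n)%N >]
               then ~` [set g | dist_int (n%:R * alpha + g) <= psi n] else setT).
  apply/seteqP; split=> g /=.
    move=> gP n _; case: asboolP => // -[An Nn] /=.
    by apply/negP; rewrite -ltNge gP.
  by move=> gP n An Nn; have := gP n I; rewrite asboolT// => /negP; rewrite -ltNge.
apply: bigcap_measurable => [|n _]; first by exists 0%N.
case: ifP => // _; apply: measurableC; exact: measurable_close.
Qed.

Lemma calT_far_from : calT A psi alpha =
  [set g | 0 <= g < 1] `\` \bigcup_N far_from A psi alpha N.
Proof.
apply/seteqP; split=> g /= [g01 gP]; split=> //.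
  move=> [N _ gN]; apply: gP; apply: (@sub_finite_set _ _ `I_N); last exact: finite_II.
  move=> n [An]; rewrite leNgt => /negP nP.
  by rewrite /= ltnNge; apply/negP => Nn; apply: nP; exact: gN.
move=> fin; apply: gP.
have /finite_seqP[s sP] := fin.
exists (\max_(i <- s) i).+1 => // n An Nn; rewrite ltNge; apply/negP => nP.
have : [set` s] n by rewrite -sP.
by move=> /= ns; have := @leq_bigmax_seq _ s xpredT id n ns isT; rewrite leqNgt Nn.
Qed.

End Measurability.

(** * Numbers that are not badly approximable *)

Lemma ler_mul_count_sum (R : realType) (s : seq nat) (P : pred nat)
    (f : nat -> R) (w : R) :
  (forall n, n \in s -> P n -> w <= f n) ->
  w * (count P s)%:R <= \sum_(n <- s | P n) f n.
Proof.
elim: s => [|m s IH] wf; first by rewrite big_nil mulr0.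
have {}IH := IH (fun n ns => wf n (mem_behead (s := m :: s) ns)).
rewrite big_cons /= natrD mulrDr; have := wf m (mem_head _ _).
by case: (P m) => [/(_ isT)|_] /=; rewrite ?mulr1 ?mulr0 ?add0r// => h; exact: lerD.
Qed.

Lemma lower_density_count (R : realType) (A : set nat) :
  (0 < lower_density R A)%E ->
  exists2 c : R, 0 < c & exists N0, forall N, (N0 <= N)%N ->
    c * N%:R <= (count (fun n => n \in A) (iota 1 N))%:R.
Proof.
move=> /limn_einf_gt0P[c c0 [N0 NP]]; exists c => //; exists N0 => -[|N] N0N.
  by rewrite mulr0.
by have := NP _ N0N; rewrite ler_pdivlMr ?ltr0n.
Qed.

(** Divergence in the extended reals is traded for unbounded partial sums over
   initial segments of the positive integers, which split into blocks as lists. *)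
Lemma sum_pinftyP (R : realType) (A : set nat) (psi : nat -> R) :
  A `<=` posnat -> (forall n, (0 < n)%N -> 0 <= psi n) ->
  (\sum_(0 <= n <oo | n \in A) (psi n)%:E = +oo)%E <->
  forall B, exists N, B <= \sum_(n <- iota 1 N | n \in A) psi n.
Proof.
move=> A_pos psi0.
have A0 n : n \in A -> (0 < n)%N by rewrite inE => /A_pos.
have psiA n : n \in A -> (0 <= (psi n)%:E)%E by move=> /A0 /psi0; rewrite lee_fin.
have partial N : (\sum_(0 <= n < N.+1 | n \in A) (psi n)%:E)%E =
    (\sum_(n <- iota 1 N | n \in A) psi n)%:E.
  rewrite sumEFin /index_iota subn0 /= big_cons.
  by case: ifP => // /A0.
split=> [dv B|dv].
  apply: contrapT => noN.
  suff : (\sum_(0 <= n <oo | n \in A) (psi n)%:E <= B%:E)%E by rewrite dv leye_eq.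
  apply: lime_le; first by apply: is_cvg_nneseries => n _ /psiA.
  apply: nearW => -[|N].
    rewrite big_geq// lee_fin leNgt; apply/negP => B0; apply: noN; exists 0%N.
    by rewrite /= big_nil ltW.
  rewrite partial lee_fin leNgt; apply/negP => BN; apply: noN; exists N.
  exact: ltW.
apply/eqyP => B _; have [N BN] := dv B.
apply: (@le_trans _ _ (\sum_(0 <= n < N.+1 | n \in A) (psi n)%:E)%E).
  by rewrite partial lee_fin.
by apply: nneseries_lim_ge => n _ /psiA.
Qed.

Lemma measure_bigU_le (R : realType) (F : nat -> set R) (e : R) q :
  (forall r, measurable (F r)) -> (forall r, (lebesgue_measure (F r) <= e%:E)%E) ->
  (lebesgue_measure (\big[setU/set0]_(r < q) F r) <= (q%:R * e)%:E)%E.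
Proof.
move=> mF Fe; elim: q => [|q IH]; first by rewrite big_ord0 measure0 mul0r.
rewrite big_ord_recr /=; apply: (le_trans (measureU2 _ _ _)).
- by apply: bigsetU_measurable => i _; exact: mF.
- exact: mF.
by rewrite -natr1 mulrDl mul1r EFinD; apply: leeD; [exact: IH|exact: Fe].
Qed.

Section NotBad.
Variables (R : realType) (A : set nat).
Hypothesis A_pos : A `<=` posnat.
Hypothesis A_density : (0 < lower_density R A)%E.
Variable alpha : R.
Hypothesis not_bad :
  ~ (0 < limn_einf (fun n : nat => (n%:R * dist_int (n%:R * alpha))%:E))%E.

Lemma good_denominators (e : R) N : 0 < e ->
  exists2 q, (N <= q)%N & q%:R * dist_int (q%:R * alpha) <= e.
Proof.
move=> e0; apply: contrapT => noq; apply/not_bad/limn_einf_gt0P; exists e => //.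
exists N => n Nn; rewrite leNgt; apply/negP => ne; apply: noq.
by exists n => //; exact: ltW.
Qed.

(** For B large, the growth condition makes the k-th block of indices, which
   ends at q k * 2 ^ (k + 5), negligible with respect to the next one. Up to a
   constant factor, the quality 2 ^ (- 2 (k + 5)) is the square of the
   proportion of [0, 1) that the k-th block will be allowed to cover. *)
Lemma sparse_denominators N0 B : exists q : nat -> nat, forall k,
  [/\ (0 < q k)%N, (N0 <= q k)%N, (q k * 2 ^ (k + 5) * B.+1 <= q k.+1)%N &
      (q k)%:R * dist_int ((q k)%:R * alpha) <= ((2 ^ (k + 5))%:R ^- 2 : R)].
Proof.
have step k N : exists q, (N <= q)%N /\
    q%:R * dist_int (q%:R * alpha) <= ((2 ^ (k + 5))%:R ^- 2 : R).
  have e0 : 0 < ((2 ^ (k + 5))%:R ^- 2 : R).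
    by rewrite invr_gt0 exprn_gt0// ltr0n expn_gt0.
  by have [q ? ?] := good_denominators N e0; exists q.
have [f fP] := choice (fun kN : nat * nat => step kN.1 kN.2).
pose q := fix q k := if k is j.+1
  then f (k, maxn (maxn 1 N0) (q j * 2 ^ (j + 5) * B.+1)) else f (0%N, maxn 1 N0).
exists q => k; have [] : (maxn 1 N0 <= q k)%N /\
    (q k)%:R * dist_int ((q k)%:R * alpha) <= ((2 ^ (k + 5))%:R ^- 2 : R).
  case: k => [|k] /=; first exact: (fP (0%N, _)).
  have [/= h1 h2] := fP (k.+1, maxn (maxn 1 N0) (q k * 2 ^ (k + 5) * B.+1)).
  by split=> //; apply: leq_trans h1; exact: leq_maxl.
rewrite geq_max => /andP[q0 qN] ->; split=> //=.
have [/= + _] := fP (k.+1, maxn (maxn 1 N0) (q k * 2 ^ (k + 5) * B.+1)).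
by apply: leq_trans; exact: leq_maxr.
Qed.


(** With K = 2 ^ (k + 5) and q ||q alpha|| <= K ^ (-2), the first q K multiples
   of alpha stay within 1 / (K q) of the first q ones, since adding q at most K
   times moves a point by at most K * K ^ (-2) / q. Taking psi = 1 / (K q) on the
   k-th block therefore covers only O(1 / K) of [0, 1). On the other hand the
   block has length about q K and A has density at least c in it, so that its
   contribution to the sum of psi over A is at least c / 2. *)
Lemma not_bad_witness : exists psi, calM A psi /\
  (lebesgue_measure (calT A psi alpha) < 1)%E.
Proof.
have [c c0 [N0 density]] := lower_density_count A_density.
(* B bounds 2 / c, so that at most half of the density of A in [1, M k.+1] is
   lost when the indices up to M k are discarded. *)
pose B := Num.truncn (2 / c).
have BP : 2 <= c * B.+1%:R.
  by rewrite mulrC -ler_pdivrMr// ltW// /B truncnS_gt.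
have [q qP] := sparse_denominators N0 B.
have [K KE] : exists K : nat -> nat, forall k, K k = (2 ^ (k + 5))%N.
  by exists (fun k => 2 ^ (k + 5))%N.
pose M k := (q k * K k)%N.
pose w k : R := ((K k)%:R * (q k)%:R)^-1.
have K0 k : (0 < K k)%N by rewrite KE expn_gt0.
have q0 k : (0 < q k)%N by have [] := qP k.
have Kpos k : 0 < (K k)%:R :> R by rewrite ltr0n.
have qpos k : 0 < (q k)%:R :> R by rewrite ltr0n.
have w0 k : 0 <= w k by rewrite invr_ge0 mulr_ge0.
have MM k : (M k * B.+1 <= q k.+1)%N by rewrite /M KE; have [] := qP k.
have qM k : (q k <= M k)%N by rewrite leq_pmulr.
have qq k : (q k <= q k.+1)%N.
  by apply: leq_trans (MM k); rewrite (leq_trans (qM k))// leq_pmulr.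
have kM k : (k < M k)%N.
  apply: (@leq_trans (K k)); last by rewrite leq_pmull.
  by rewrite KE (leq_trans (ltn_expl k (isT : 1 < 2)%N))// leq_exp2l ?leq_addr.
have wS k : w k.+1 <= w k.
  rewrite lef_pV2 ?posrE ?mulr_gt0// ler_pM// ?ler_nat//.
  by rewrite !KE leq_exp2l ?leq_add2r.
have w_mono j k : (j <= k)%N -> w k <= w j.
  move=> /subnK <-; elim: (k - j)%N => // i; rewrite addSn; exact: le_trans.
have ex n : exists k, (n <= M k)%N by exists n; rewrite ltnW.
pose blk n := ex_minn (ex n).
have blkP n : (n <= M (blk n))%N by rewrite /blk; case: ex_minnP.
have blk_min n k : (n <= M k)%N -> (blk n <= k)%N.
  by rewrite /blk; case: ex_minnP => m _ + nk; exact.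
pose psi n := w (blk n).
have psi_ge n k : (n <= M k)%N -> w k <= psi n by move=> /blk_min /w_mono.
have psiM : calM A psi.
  split=> [n _|m n _ mn|]; first exact: w0.
    by apply/w_mono/blk_min; exact: leq_trans mn _.
  apply/(sum_pinftyP A_pos); first by move=> n _; exact: w0.
  have grow k : k%:R * (c / 2) <= \sum_(n <- iota 1 (M k) | n \in A) psi n.
    elim: k => [|k IH]; first by rewrite mul0r; apply: sumr_ge0 => n _; exact: w0.
    have Mk : (M k <= M k.+1)%N.
      by apply: leq_trans (qM _); apply: leq_trans (MM k); rewrite leq_pmulr.
    rewrite -(subnKC Mk) iotaD big_cat /= -natr1 mulrDl mul1r lerD//.
    set s := iota _ (M k.+1 - M k).
    apply: (@le_trans _ _ (w k.+1 * (count (fun n => n \in A) s)%:R)); last first.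
      apply: ler_mul_count_sum => n; rewrite mem_iota add1n => /andP[_].
      by rewrite addSn subnKC// ltnS => /psi_ge.
    have : c * (M k.+1)%:R <= (M k)%:R + (count (fun n => n \in A) s)%:R.
      apply: (le_trans (density _ _)).
        by apply: leq_trans (qM _); have [] := qP k.+1.
      rewrite -{1}(subnKC Mk) iotaD count_cat natrD lerD2r ler_nat.
      by rewrite (leq_trans (count_size _ _))// size_iota.
    have : (M k)%:R <= c / 2 * (M k.+1)%:R :> R.
      have := MM k; rewrite -(ler_nat R) natrM => /(ler_wpM2l (ltW c0)).
      rewrite mulrCA => h; have : c * (q k.+1)%:R <= c * (M k.+1)%:R.
        by rewrite ler_pM2l// ler_nat.
      have : (M k)%:R * 2 <= (M k)%:R * (c * B.+1%:R) by rewrite ler_wpM2l.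
      by lra.
    move=> h1 h2; have {h1 h2} h :
        c / 2 * (M k.+1)%:R <= (count (fun n => n \in A) s)%:R by lra.
    apply: le_trans (ler_wpM2l (w0 _) h).
    rewrite /w /M natrM (mulrC (K _)%:R) mulrCA mulVf ?mulr1//.
    by rewrite mulf_neq0// gt_eqF.
  move=> b; pose k := Num.truncn (b / (c / 2)).
  exists (M k.+1); apply: (le_trans _ (grow _)).
  by rewrite -ler_pdivrMr ?divr_gt0// ltW// truncnS_gt.
exists psi; split=> //.
pose near r k := [set g : R | 0 <= g < 1 /\ dist_int (r%:R * alpha + g) <= 2 * w k].
pose E k := \big[setU/set0]_(r < q k) near r k.
have m01 : measurable [set g : R | 0 <= g < 1].
  have -> : [set g : R | 0 <= g < 1] = `[0, 1[%classic.
    by apply/seteqP; split=> g /=; rewrite in_itv.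
  exact: measurable_itv.
have mnear r k : measurable (near r k).
  by apply: measurableI => //; exact: measurable_close.
have mE k : measurable (E k) by apply: bigsetU_measurable => i _; exact: mnear.
have wK k : w k * (K k)%:R * (q k)%:R = 1.
  by rewrite -mulrA mulVf// mulf_neq0// gt_eqF.
have K32 k : 32%:R <= (K k)%:R :> R.
  by rewrite KE ler_nat (@leq_exp2l 2 5) ?leq_addl.
have muE k : (lebesgue_measure (E k) <= (3 / 4 / (2 ^ k.+1)%:R)%:E)%E.
  have w1 : 2 * w k < 1.
    have := wK k; have := K32 k; have := w0 k; set a := w k; set b := (K k)%:R.
    have q1 : 1 <= (q k)%:R :> R by rewrite ler1n.
    move=> a0 b32 abq.
    have : a * b * 1 <= a * b * (q k)%:R by rewrite ler_wpM2l// mulr_ge0// ?ltW// /b ltr0n.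
    have : a * 32%:R <= a * b by rewrite ler_wpM2l.
    by lra.
  apply: (@le_trans _ _ ((q k)%:R * (6 * (2 * w k)))%:E).
    apply: (@measure_bigU_le R (near^~ k) (6 * (2 * w k))) => r; first exact: mnear.
    by apply: (@close_measure_le R (r%:R * alpha) (2 * w k)) => //; rewrite mulr_ge0.
  rewrite lee_fin ler_pdivlMr ?ltr0n ?expn_gt0//.
  have -> : (q k)%:R * (6 * (2 * w k)) = 12 / (K k)%:R.
    apply: (canRL (mulfK (lt0r_neq0 (Kpos k)))).
    by rewrite -[RHS]mulr1 -[X in _ = _ * X](wK k); ring.
  rewrite KE (_ : k + 5 = 4 + k.+1)%N; last by lia.
  rewrite expnD natrM; have : 0 < (2 ^ k.+1)%:R :> R by rewrite ltr0n expn_gt0.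
  move=> h; rewrite le_eqVlt; apply/orP; left; apply/eqP; field.
  by rewrite pnatr_eq0 expn_eq0.
have cover : calT A psi alpha `<=` \bigcup_k E k.
  move=> g [g01 inf]; have [n [An ng]] := infinite_setN0 inf.
  set k := blk n; exists k => //.
  have nq : (n %% q k < q k)%N by rewrite ltn_pmod.
  rewrite /E (bigD1 (Ordinal nq))//=; left; split=> //.
  (* n = j q + r with j <= K: replacing n by r costs at most j ||q alpha|| <= w *)
  have nE : (n %% q k)%:R * alpha + g =
      (n%:R * alpha + g) + (- ((n %/ q k)%:R * ((q k)%:R * alpha))).
    by rewrite [in n%:R](divn_eq n (q k)) natrD natrM; ring.
  rewrite nE (le_trans (dist_int_triangle _ _))// mulrDl mul1r lerD// dist_intN.
  apply: (le_trans (dist_int_mulrn _ _)).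
  have jK : (n %/ q k)%:R <= (K k)%:R :> R.
    by rewrite ler_nat -(mulKn (K k) (q0 k)); apply: leq_div2r; exact: blkP.
  have [_ _ _ qd] := qP k.
  apply: (@le_trans _ _ ((K k)%:R * dist_int ((q k)%:R * alpha))).
    by rewrite ler_wpM2r// dist_int_ge0.
  rewrite /w invfM mulrC -ler_pdivlMr// -(ler_pM2l (qpos k)).
  apply: (le_trans qd); rewrite -KE le_eqVlt; apply/orP; left; apply/eqP.
  by field; rewrite !gt_eqF.
apply: (@le_lt_trans _ _ (3 / 4)%:E); last by rewrite lte_fin; lra.
apply: (@le_trans _ _ (\sum_(k <oo) lebesgue_measure (E k))%E).
  apply: measure_sigma_subadditive => //.
  rewrite calT_far_from; apply: measurableD => //.
  by apply: bigcup_measurable => N _; exact: measurable_far_from.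
apply: (@le_trans _ _ (\sum_(k <oo) (3 / 4 / (2 ^ k.+1)%:R)%:E)%E).
  by apply: lee_nneseries => k _ //; exact: measure_ge0.
by apply: epsilon_trick0; lra.
Qed.

End NotBad.

(** * Greedy packing of balls with separated centres *)

(** Pigeonhole: points at mutual distance at least d lie in distinct cells of
   the grid of step d that starts at u. *)
Lemma separated_size (R : realType) (y : nat -> R) (s : seq nat) (u v d : R) :
  0 < d -> u <= v -> uniq s ->
  (forall i, i \in s -> u <= y i <= v) ->
  (forall i j, i \in s -> j \in s -> i != j -> d <= `|y i - y j|) ->
  (size s)%:R <= 1 + (v - u) / d.
Proof.
move=> d0 uv us ys ds; pose h i := Num.truncn ((y i - u) / d).
have ge0 i : i \in s -> 0 <= (y i - u) / d.
  by move=> /ys /andP[yu _]; rewrite divr_ge0// ?subr_ge0// ltW.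
have inj : {in s &, injective h}.
  move=> i j is_ js eh; apply/eqP; apply: contraT => /(ds _ _ is_ js).
  have /andP[i1 i2] := truncn_itv (ge0 i is_).
  have /andP[j1 j2] := truncn_itv (ge0 j js).
  move: i1 i2 j1 j2; rewrite -/(h i) -/(h j) -eh -natr1 => i1 i2 j1 j2.
  rewrite leNgt => /negP[].
  have -> : y i - y j = ((y i - u) / d - (y j - u) / d) * d by field; exact: lt0r_neq0.
  rewrite normrM (gtr0_norm d0) -[ltRHS]mul1r ltr_pM2r// ltr_norml.
  by apply/andP; split; lra.
have sz : (size s <= (Num.truncn ((v - u) / d)).+1)%N.
  rewrite -(size_map h) -[X in (_ <= X)%N](size_iota 0); apply: uniq_leq_size.
    by rewrite map_inj_in_uniq.
  move=> _ /mapP[i is_ ->]; rewrite mem_iota add0n ltnS /=.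
  have /andP[i1 _] := truncn_itv (ge0 i is_).
  rewrite truncn_ge_nat; last by rewrite divr_ge0 ?subr_ge0// ltW.
  apply: (le_trans i1).
  by rewrite ler_pM2r ?invr_gt0// lerD2r; have /andP[] := ys _ is_.
apply: (@le_trans _ _ (Num.truncn ((v - u) / d)).+1%:R); first by rewrite ler_nat.
by rewrite -natr1 addrC lerD2l truncn_le divr_ge0 ?subr_ge0// ltW.
Qed.

Lemma count_has_le (P : nat -> pred nat) (t s : seq nat) :
  (count (fun m => has (P^~ m) t) s <= \sum_(n <- t) count (P n) s)%N.
Proof.
elim: t => [|n t IH]; first by rewrite big_nil /= count_pred0.
rewrite big_cons /=; apply: leq_trans (leq_add (leqnn _) IH).
by rewrite -count_predUI; apply: leq_trans (leq_addr _ _); exact: sub_count.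
Qed.

Section Packing.
Variables (R : realType) (C : pred nat) (y r : nat -> R).

(** Disjointness of the closed intervals of centres y m, y n and radii
   r m, r n. *)
Definition disjoint_balls m n := r m + r n < `|y m - y n|.

(** Scanning the indices upwards, keep those of C whose ball meets no ball kept
   so far. The total length of the kept balls is then the measure of their
   union, so a bound on it limits at once the room the kept balls occupy and the
   number of later balls they can obstruct. *)
Fixpoint greedy (N : nat) : seq nat :=
  if N is n.+1 then
    if C n && all (disjoint_balls n) (greedy n) then n :: greedy n else greedy n
  else [::].

Definition selected n := C n && all (disjoint_balls n) (greedy n).

Lemma mem_greedy N n : (n \in greedy N) = (n < N)%N && selected n.
Proof.
elim: N => [|N IH] //=; rewrite -/(selected N) ltnS leq_eqVlt.
case: ifP => sN; rewrite ?inE IH; case: (ltngtP n N) => //= ->.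
  by rewrite sN.
by rewrite sN.
Qed.

Lemma greedy_pairwise N : pairwise disjoint_balls (greedy N).
Proof. by elim: N => //= N IH; case: ifP => //= /andP[_ ->]. Qed.

Lemma sum_greedy (f : nat -> R) N :
  \sum_(n <- greedy N) f n = \sum_(n <- iota 0 N | selected n) f n.
Proof.
elim: N => [|N IH]; first by rewrite !big_nil.
rewrite -addn1 iotaD big_cat addn1 /= -/(selected N) -IH add0n big_cons big_nil.
by case: ifP => _; rewrite ?big_cons addr0// addrC.
Qed.

Lemma size_greedy N : size (greedy N) = count selected (iota 0 N).
Proof.
elim: N => // N IH; rewrite -addn1 iotaD count_cat addn1 /= -/(selected N) -IH.
by rewrite add0n !addn0; case: ifP => _; rewrite ?addn0 ?addn1.
Qed.

#[local] Arguments greedy : simpl never.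

Variables (c : R) (L : nat).
Hypotheses (c0 : 0 < c) (L0 : (0 < L)%N).
Hypothesis C_pos : forall n, C n -> (0 < n)%N.
Hypothesis r_ge0 : forall n, (0 < n)%N -> 0 <= r n.
Hypothesis r_anti : forall m n, (0 < m)%N -> (m <= n)%N -> r n <= r m.
Hypothesis r_small : forall n, (0 < n)%N -> r n <= c / (4 * L%:R) / n%:R.
Hypothesis y_sep : forall m n N, m != n -> (m <= N)%N -> (n <= N)%N ->
  c / N%:R <= `|y m - y n|.

(** Inside a block ]M, L M] the separation of the points exceeds the sum of two
   radii, so a rejection there is always caused by an index up to M, whose
   radius is the larger of the two. *)
Lemma rejected_close M m : (0 < M)%N -> (M < m <= L * M)%N -> C m -> ~~ selected m ->
  has (fun n => `|y m - y n| <= 2 * r n) (greedy M.+1).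
Proof.
move=> M0 /andP[Mm mL] Cm; rewrite /selected Cm /= -has_predC.
move=> /hasP[n]; rewrite mem_greedy => /andP[nm sn].
rewrite /disjoint_balls /= -leNgt => close.
have n0 : (0 < n)%N by apply: C_pos; case/andP: sn.
have rmn : r m <= r n by apply: r_anti => //; exact: ltnW.
have L0' : 0 < L%:R :> R by rewrite ltr0n.
have M0' : 0 < M%:R :> R by rewrite ltr0n.
have nM : (n <= M)%N.
  rewrite leqNgt; apply/negP => Mn.
  have := @y_sep m n (L * M) (negbT (gtn_eqF nm)) mL (leq_trans (ltnW nm) mL).
  have : r n <= c / (4 * L%:R) / M%:R.
    by apply: le_trans (r_small M0); apply: r_anti => //; exact: ltnW.
  have : 0 < c / (L * M)%:R by rewrite divr_gt0// ltr0n muln_gt0 L0.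
  have -> : c / (4 * L%:R) / M%:R = (c / (L * M)%:R) / 4.
    by rewrite natrM; field; rewrite !gt_eqF.
  by lra.
apply/hasP; exists n; first by rewrite mem_greedy ltnS nM.
by lra.
Qed.

Lemma count_close M n : (0 < M)%N -> (0 < n)%N ->
  (count (fun m => `|y m - y n| <= 2 * r n) (iota M.+1 (L * M - M)))%:R
    <= 1 + 4 * (L * M)%:R / c * r n.
Proof.
move=> M0 n0; rewrite -size_filter.
have LM0 : 0 < (L * M)%:R :> R by rewrite ltr0n muln_gt0 L0.
have -> : 4 * (L * M)%:R / c * r n =
    ((y n + 2 * r n) - (y n - 2 * r n)) / (c / (L * M)%:R).
  by move: LM0; move: (_%:R) => z z0; field; rewrite !gt_eqF.
apply: (@separated_size _ y).
- by rewrite divr_gt0.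
- by have := r_ge0 n0; lra.
- by rewrite filter_uniq// iota_uniq.
- move=> i; rewrite mem_filter => /andP[+ _].
  by rewrite ler_norml => /andP[h1 h2]; apply/andP; split; lra.
have le i : i \in iota M.+1 (L * M - M) -> (i <= L * M)%N.
  by rewrite mem_iota addSn subnKC ?leq_pmull// => /andP[].
move=> i j; rewrite !mem_filter => /andP[_ /le iL] /andP[_ /le jL] ij.
exact: y_sep.
Qed.

(** A kept index n <= M obstructs at most 1 + 4 (L M / c) r n indices of the
   block. Summing over n, the terms 1 are bounded by the number of indices of C
   up to M, and the other terms by the sum of the kept radii. *)
Lemma count_selected M : (0 < M)%N ->
  (count C (iota M.+1 (L * M - M)))%:R - (count C (iota 1 M))%:R
    - 4 * (L * M)%:R / c * (\sum_(n <- greedy M.+1) r n)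
  <= (count selected (iota M.+1 (L * M - M)))%:R.
Proof.
move=> M0; set s := iota M.+1 _.
pose bad := fun m => has (fun n => `|y m - y n| <= 2 * r n) (greedy M.+1).
have CU : (count C s <= count selected s + count bad s)%N.
  rewrite -count_predUI; apply: leq_trans (leq_addr _ _).
  rewrite -!size_filter; apply: uniq_leq_size; first by rewrite filter_uniq// iota_uniq.
  move=> m; rewrite !mem_filter => /andP[Cm ms]; rewrite ms andbT /=.
  case: (boolP (selected m)) => //= nsel.
  apply: rejected_close => //; move: ms.
  by rewrite mem_iota addSn subnKC ?leq_pmull.
have badle : (count bad s)%:R <=
    (count C (iota 1 M))%:R + 4 * (L * M)%:R / c * (\sum_(n <- greedy M.+1) r n).
  apply: (@le_trans _ _ (\sum_(n <- greedy M.+1)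
      count (fun m => `|y m - y n| <= 2 * r n)%R s)%:R).
    by rewrite ler_nat; exact: (@count_has_le (fun n m => `|y m - y n| <= 2 * r n)%R).
  apply: (@le_trans _ _ (\sum_(n <- greedy M.+1) (1 + 4 * (L * M)%:R / c * r n))).
    rewrite natr_sum big_seq [leRHS]big_seq; apply: ler_sum => n.
    rewrite mem_greedy => /andP[_ /andP[/C_pos n0 _]]; exact: count_close.
  rewrite big_split /= -mulr_sumr lerD2r.
  have -> : \sum_(n <- greedy M.+1) (1 : R) = (size (greedy M.+1))%:R.
    by rewrite big_const_seq count_predT iter_addr addr0.
  rewrite size_greedy /= ler_nat.
  have -> : selected 0 = false by apply/negP => /andP[/C_pos].
  by rewrite add0n; apply: sub_count => n /andP[].
by move: CU; rewrite -(ler_nat R) natrD; lra.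
Qed.

(** Suppose that the kept radii never added up to tau * c / 8. Then at least
   half of the tau L M available indices of each block ]M, L M] would be kept,
   each with a radius at least r (L M), and the sum of the kept radii would
   dominate a divergent series. *)
Lemma greedy_sum_large (tau : R) M1 :
  (1 < L)%N -> 0 < tau ->
  (forall M, (M1 <= M)%N -> tau * (L * M)%:R <=
     (count C (iota M.+1 (L * M - M)))%:R - (count C (iota 1 M))%:R) ->
  (forall B k1, exists K,
     B <= \sum_(k1 <= k < K) (L ^ k.+1)%:R * r (L ^ k.+1)) ->
  exists N, tau * c / 8 <= \sum_(n <- greedy N) r n.
Proof.
move=> L1 tau0 many dv; apply: contrapT => small.
have W N : \sum_(n <- greedy N) r n <= tau * c / 8.
  by rewrite leNgt; apply/negP => h; apply: small; exists N; exact: ltW.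
have [K] := dv (2 / tau * (tau * c / 8 + 1)) M1; apply/negP; rewrite -ltNge.
suff partial j : tau / 2 * \sum_(M1 <= k < M1 + j) (L ^ k.+1)%:R * r (L ^ k.+1)
    <= \sum_(n <- greedy (L ^ (M1 + j)).+1) r n.
  have [MK|KM] := leqP M1 K; last first.
    rewrite big_geq ?(ltnW KM)// mulr_gt0// ?divr_gt0//.
    have : 0 < tau * c / 8 by rewrite divr_gt0// mulr_gt0.
    by lra.
  have := partial (K - M1)%N; rewrite subnKC// => h.
  have := le_trans h (W _); rewrite -ler_pdivlMl ?divr_gt0// invf_div => {}h.
  by apply: (le_lt_trans h); rewrite ltr_pM2l ?divr_gt0//; lra.
have Lpos k : (0 < L ^ k)%N by rewrite expn_gt0 L0.
elim: j => [|j IH].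
  rewrite addn0 big_geq// mulr0 sum_greedy big_seq_cond sumr_ge0// => n.
  by move=> /andP[_ /andP[/C_pos n0 _]]; exact: r_ge0.
rewrite addnS big_nat_recr ?leq_addr//= mulrDr.
set k := (M1 + j)%N; set M := (L ^ k)%N; have M0 : (0 < M)%N by exact: Lpos.
have M1M : (M1 <= M)%N by rewrite (leq_trans (leq_addr j _))// ltnW// ltn_expl.
have eS : (L ^ k.+1 = L * M)%N by rewrite expnS.
have MLM : (M <= L * M)%N by rewrite leq_pmull.
rewrite eS [leRHS]sum_greedy -(subnKC (MLM : M < (L * M).+1)%N) iotaD big_cat.
rewrite -sum_greedy add0n subSS; apply: lerD => //=.
apply: le_trans (@ler_mul_count_sum _ _ _ _ (r (L * M)) _); last first.
  move=> n; rewrite mem_iota addSn subnKC// => /andP[Mn nL] _.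
  by apply: r_anti => //; exact: leq_ltn_trans Mn.
rewrite mulrA mulrC; apply: ler_wpM2l; first by apply: r_ge0; rewrite muln_gt0 L0.
apply: le_trans (count_selected M0).
have := many _ M1M.
have : 4 * (L * M)%:R / c * (\sum_(n <- greedy M.+1) r n) <=
    4 * (L * M)%:R / c * (tau * c / 8).
  by apply: ler_wpM2l (W _); rewrite divr_ge0// ?ltW// mulr_ge0.
have -> : 4 * (L * M)%:R / c * (tau * c / 8) = tau / 2 * (L * M)%:R.
  by field; rewrite gt_eqF.
by lra.
Qed.

End Packing.

(** * Condensation, and counting along the enumeration of A *)

Section Condensation.
Variable R : realType.

(** Either the truncation is eventually inactive, or it contributes the constant
   eta infinitely often. *)
Lemma truncated_series_diverges (a : nat -> R) (eta : R) :
  0 < eta -> (forall k, 0 <= a k) ->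
  (forall B, exists K, B <= \sum_(0 <= k < K) a k) ->
  forall B k1, exists K, B <= \sum_(k1 <= k < K) Num.min (a k) eta.
Proof.
move=> eta0 a0 dv B k1.
have min0 k : 0 <= Num.min (a k) eta by rewrite le_min a0 ltW.
have [[k2 small]|often] := pselect (exists k2, forall k, (k2 <= k)%N -> a k < eta).
  pose m := maxn k1 k2; have [K hK] := dv (B + \sum_(0 <= k < m) a k).
  exists (maxn m K); apply: (@le_trans _ _ (\sum_(m <= k < maxn m K) a k)).
    rewrite -(lerD2r (\sum_(0 <= k < m) a k)); apply: (le_trans hK).
    rewrite [leRHS]addrC -big_cat_nat ?leq_maxl//=.
    rewrite [leRHS](@big_cat_nat _ _ _ K)//= ?leq_maxr//.
    by rewrite lerDl sumr_ge0.
  rewrite [leRHS](@big_cat_nat _ _ _ m)//= ?leq_maxl//.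
  apply: (@le_trans _ _ (\sum_(m <= k < maxn m K) Num.min (a k) eta)).
    rewrite big_nat [leRHS]big_nat; apply: ler_sum => k /andP[mk _].
    rewrite le_min lexx ltW// small//; apply: leq_trans mk; exact: leq_maxr.
  by rewrite lerDr sumr_ge0.
have steps j : exists2 K, (k1 <= K)%N &
    j%:R * eta <= \sum_(k1 <= k < K) Num.min (a k) eta.
  elim: j => [|j [K kK IH]]; first by exists k1 => //; rewrite mul0r big_geq.
  have [k [Kk ak]] : exists k, (K <= k)%N /\ eta <= a k.
    apply: contrapT => nok; apply: often; exists K => k Kk.
    by rewrite ltNge; apply/negP => ak; apply: nok; exists k.
  exists k.+1; first by rewrite (leq_trans kK)// (leq_trans Kk).
  rewrite big_nat_recr/= ?(leq_trans kK)// (min_idPr ak) -natr1 mulrDl mul1r lerD2r.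
  rewrite (@big_cat_nat _ _ _ K)//=; apply: (le_trans IH).
  by rewrite lerDl sumr_ge0.
have [K _ hK] := steps (Num.truncn (B / eta)).+1; exists K; apply: le_trans hK.
by rewrite -ler_pdivrMr// ltW// truncnS_gt.
Qed.

Lemma condensation (f : nat -> R) (L K : nat) : (1 < L)%N ->
  (forall n, (0 < n)%N -> 0 <= f n) ->
  (forall m n, (0 < m)%N -> (m <= n)%N -> f n <= f m) ->
  \sum_(n <- iota 1 (L ^ K)) f n <=
    f 1%N + L%:R * \sum_(0 <= k < K) (L ^ k)%:R * f (L ^ k)%N.
Proof.
move=> L1 f0 fa; have L0 := ltnW L1.
elim: K => [|K IH].
  by rewrite expn0 /= big_cons big_nil big_geq// mulr0.
have LK : (L ^ K <= L ^ K.+1)%N by rewrite leq_exp2l.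
have LK0 : (0 < L ^ K)%N by rewrite expn_gt0 L0.
rewrite -(subnKC LK) iotaD big_cat /= [in leRHS]big_nat_recr//= mulrDr addrA lerD//.
apply: (@le_trans _ _ (\sum_(n <- iota (1 + L ^ K) (L ^ K.+1 - L ^ K)) f (L ^ K)%N)).
  rewrite big_seq [leRHS]big_seq; apply: ler_sum => n.
  by rewrite mem_iota add1n => /andP[h _]; apply: fa => //; exact: ltnW.
rewrite big_const_seq count_predT size_iota iter_addr addr0 mulrA -[leLHS]mulr_natl.
by rewrite ler_wpM2r ?f0// -natrM -expnS ler_nat leq_subr.
Qed.

(** Truncating psi at eta / n becomes, after condensation along the powers of L,
   truncating the terms of a divergent series at the constant eta; this is why
   the radii can be shrunk below the separation of the points without losing
   divergence. *)
Lemma dyadic_truncation_diverges (A : set nat) (psi : nat -> R) (eta : R) (L : nat) :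
  A `<=` posnat -> calM A psi -> 0 < eta -> (1 < L)%N ->
  forall B k1, exists K, B <=
    \sum_(k1 <= k < K) (L ^ k.+1)%:R * Num.min (psi (L ^ k.+1)%N) (eta / (L ^ k.+1)%:R).
Proof.
move=> A_pos [psi0 psia dv] eta0 L1 B k1.
have L0 := ltnW L1; have Lpos k : (0 < L ^ k)%N by rewrite expn_gt0 L0.
have Lr k : 0 < (L ^ k)%:R :> R by rewrite ltr0n.
pose a k : R := (L ^ k)%:R * psi (L ^ k)%N.
have a0 k : 0 <= a k by rewrite mulr_ge0// psi0.
have adv C : exists K, C <= \sum_(0 <= k < K) a k.
  have /sum_pinftyP := dv; move=> /(_ A_pos psi0 (psi 1%N + L%:R * C))[N hN].
  exists N; have Lp : 0 < L%:R :> R by rewrite ltr0n.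
  rewrite -(ler_pM2l Lp) -(lerD2l (psi 1%N)).
  apply: le_trans (@condensation psi L N L1 psi0 psia); apply: (le_trans hN).
  have NL : (N <= L ^ N)%N by rewrite ltnW// ltn_expl.
  rewrite -(subnKC NL) iotaD big_cat /= -[leLHS]addr0 lerD//; last first.
    by rewrite big_seq sumr_ge0// => n; rewrite mem_iota => /andP[h _]; apply: psi0; lia.
  rewrite big_mkcond big_seq [leRHS]big_seq; apply: ler_sum => n.
  by rewrite mem_iota => /andP[n0 _]; case: ifP => // _; exact: psi0.
have [K hK] := truncated_series_diverges eta0 a0 adv B k1.+1.
exists K; apply: (le_trans hK).
have E k : (L ^ k)%:R * Num.min (psi (L ^ k)%N) (eta / (L ^ k)%:R) = Num.min (a k) eta.
  by rewrite minr_pMr ?ltW// (mulrC _ (eta / _)) divfK// gt_eqF.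
under [leRHS]eq_bigr do rewrite E.
have min0 k : 0 <= Num.min (a k) eta by rewrite le_min a0 ltW.
rewrite big_add1/=; case: K {hK} => [|K] /=; first by rewrite !big_geq.
have [kK|Kk] := leqP k1 K; first by rewrite big_nat_recr//= lerDl.
by rewrite big_geq ?sumr_ge0// ltnW.
Qed.

End Condensation.

Section Enumeration.
Variables (A : set nat) (a : nat -> nat).
Hypotheses (A_pos : A `<=` posnat) (A_enum : increasing_enum A a).

(** An initial segment of A is an initial segment of its enumeration, which
   converts averages along the enumeration into averages over A. *)
Lemma increasing_enum_filter N :
  exists m, [seq n <- iota 1 N | n \in A] = map a (iota 0 m).
Proof.
have [a_incr aA] := A_enum.
have a_inj i j : (a i < a j)%N -> (i < j)%N.
  by case: (ltngtP i j) => // [/a_incr|->]; [case: ltngtP|rewrite ltnn].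
elim: N => [|N [m IH]]; first by exists 0%N.
rewrite -[N.+1]addn1 iotaD filter_cat IH add1n /=.
case: ifPn => [|_]; last by exists m; rewrite cats0.
rewrite inE -aA => -[j _ aj].
have memE i : (i < m)%N = (a i <= N)%N.
  apply/idP/idP => [im|ai].
    have : a i \in map a (iota 0 m) by apply: map_f; rewrite mem_iota.
    by rewrite -IH mem_filter mem_iota => /andP[_]; lia.
  have : a i \in [seq n <- iota 1 N | n \in A].
    have Aai : A (a i) by rewrite -aA; exists i.
    by rewrite mem_filter mem_iota mem_set//=; have := A_pos Aai; rewrite /posnat/=; lia.
  rewrite IH => /mapP[k]; rewrite mem_iota add0n => /andP[_ km] aik.
  have [//|mi] := ltnP i m.
  by have := a_incr _ _ (leq_trans km mi); rewrite aik ltnn.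
have -> : N.+1 = a m.
  rewrite -aj; congr a; apply/eqP; rewrite eqn_leq; apply/andP; split; last first.
    by rewrite leqNgt memE aj ltnn.
  rewrite leqNgt; apply/negP => /a_incr; rewrite aj ltnS -memE ltnn//.
by exists m.+1; rewrite -[m.+1]addn1 iotaD map_cat.
Qed.

Lemma equidistributed_count (R : realType) (alpha s t e : R) :
  (0 < lower_density R A)%E ->
  unif_distr_mod1 (fun k : nat => (a k)%:R * alpha) ->
  0 <= s -> s < t -> t <= 1 -> 0 < e ->
  exists N1, forall N, (N1 <= N)%N ->
    `|(count (fun n => (n \in A) && (s <= frac_part (n%:R * alpha) < t)) (iota 1 N))%:R
      - (t - s) * (count (fun n => n \in A) (iota 1 N))%:R|
    <= e * (count (fun n => n \in A) (iota 1 N))%:R.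
Proof.
move=> dens ud s0 st t1 e0.
have [c c0 [N0 cP]] := lower_density_count dens.
have /cvgrPdist_le/(_ _ e0)[m0 _ m0P] := ud s t s0 st t1.
exists (maxn N0 (Num.truncn (m0.+1%:R / c)).+1) => N.
rewrite geq_max => /andP[N0N NN].
have [m mP] := increasing_enum_filter N.
have cm : count (fun n => n \in A) (iota 1 N) = m.
  by rewrite -size_filter mP size_map size_iota.
have m0m : (m0.+1 <= m)%N.
  rewrite -(ler_nat R) -cm; apply: le_trans (cP _ N0N).
  rewrite mulrC -ler_pdivrMr// ltW//; apply: (lt_le_trans (truncnS_gt _)).
  by rewrite ler_nat.
have m_gt0 : 0 < m%:R :> R by rewrite ltr0n; exact: leq_trans m0m.
have := m0P m (ltnW m0m); rewrite /= cm.
have -> : count (fun n => (n \in A) && (s <= frac_part (n%:R * alpha) < t)) (iota 1 N)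
    = count (fun k => s <= frac_part ((a k)%:R * alpha) < t) (iota 0 m).
  rewrite -(count_map a (fun n => s <= frac_part (n%:R * alpha) < t)) -mP count_filter.
  by apply: eq_count => n /=; rewrite andbC.
set x := (count _ _)%:R => h.
have -> : x - (t - s) * m%:R = - ((t - s - x / m%:R) * m%:R).
  by field; rewrite gt_eqF.
by rewrite normrN normrM (gtr0_norm m_gt0) ler_pM2r.
Qed.

End Enumeration.

(** * Separation, measure of disjoint balls, density points *)

(** The lower limit only controls large n. A small n is reached through its
   multiple n N, for which n N is large and ||n N alpha|| <= N ||n alpha||. *)
Lemma bad_uniform (R : realType) (alpha : R) :
  (0 < limn_einf (fun n : nat => (n%:R * dist_int (n%:R * alpha))%:E))%E ->
  exists2 c, 0 < c & forall n, (0 < n)%N -> c <= n%:R * dist_int (n%:R * alpha).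
Proof.
move=> /limn_einf_gt0P[c c0 [N NP]].
have N1 : 0 < N.+1%:R :> R by rewrite ltr0n.
exists (c / N.+1%:R ^+ 2) => [|n n0]; first by rewrite divr_gt0// exprn_gt0.
rewrite ler_pdivrMr ?exprn_gt0//.
have := NP (N.+1 * n)%N; rewrite natrM => /(_ _) h.
apply: (le_trans (h _)); first by rewrite (leq_trans (leqnSn N))// leq_pmulr.
rewrite expr2 -mulrA [in leRHS]mulrCA mulrA [leRHS]mulrA.
have := dist_int_mulrn (n%:R * alpha) N.+1; rewrite [N.+1%:R * (_ * _)]mulrA.
set D := dist_int (n%:R * alpha) => hD.
have : N.+1%:R * n%:R * dist_int (N.+1%:R * n%:R * alpha) <=
    N.+1%:R * n%:R * (N.+1%:R * D) by rewrite ler_wpM2l// mulr_ge0.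
by move=> /le_trans; apply; rewrite le_eqVlt; apply/orP; left; apply/eqP; ring.
Qed.

(** The fractional parts of m alpha and n alpha differ from (m - n) alpha by an
   integer, so they are at least ||(m - n) alpha|| apart, with m - n <= N. *)
Lemma frac_part_separated (R : realType) (alpha c : R) :
  0 < c -> (forall n, (0 < n)%N -> c <= n%:R * dist_int (n%:R * alpha)) ->
  forall m n N, m != n -> (m <= N)%N -> (n <= N)%N ->
    c / N%:R <= `|frac_part (m%:R * alpha) - frac_part (n%:R * alpha)|.
Proof.
move=> c0 cP; have sep m n N : (n < m)%N -> (m <= N)%N ->
    c / N%:R <= `|frac_part (m%:R * alpha) - frac_part (n%:R * alpha)|.
  move=> nm mN; have mn0 : (0 < m - n)%N by rewrite subn_gt0.
  have N0 : 0 < N%:R :> R by rewrite ltr0n; lia.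
  rewrite ler_pdivrMr// mulrC; apply: (le_trans (cP _ mn0)).
  apply: (@le_trans _ _ (N%:R * dist_int ((m - n)%:R * alpha))).
    by rewrite ler_wpM2r ?dist_int_ge0// ler_nat; lia.
  rewrite ler_pM2l// (le_trans (dist_int_le _
    (Num.floor (m%:R * alpha) - Num.floor (n%:R * alpha))))//.
  rewrite natrB ?(ltnW nm)// intrB /frac_part le_eqVlt; apply/orP; left; apply/eqP.
  by congr `|_|; ring.
move=> m n N mn mN nN; case: (ltngtP m n) mn => // h _; last exact: sep.
by rewrite distrC; exact: sep.
Qed.

Lemma measure_disjoint_balls (R : realType) (F : set R) (y r : nat -> R) (s : seq nat) :
  measurable F ->
  (forall n, n \in s -> 0 <= r n) ->
  (forall n g, n \in s -> F g -> ~ (y n - r n <= g <= y n + r n)) ->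
  pairwise (disjoint_balls y r) s ->
  (lebesgue_measure F + (2 * \sum_(n <- s) r n)%:E <=
   lebesgue_measure (F `|` [set g | exists2 n, n \in s & (y n - r n <= g <= y n + r n)%R]))%E.
Proof.
move=> mF; pose D (t : seq nat) := F `|` [set g | exists2 n, n \in t & (y n - r n <= g <= y n + r n)%R].
rewrite -/(D s).
pose I n := `[y n - r n, y n + r n]%classic : set R.
have mI n : measurable (I n) by exact: measurable_itv.
have DS n t : D (n :: t) = I n `|` D t.
  apply/seteqP; split=> g.
    move=> [Fg|[m]]; first by right; left.
    rewrite inE => /orP[/eqP -> h|mt h]; last by right; right; exists m.
    by left; rewrite /I /= in_itv.
  move=> [|[Fg|[m mt h]]]; last by right; exists m => //; rewrite inE mt orbT.
    by rewrite /I /= in_itv /= => h; right; exists n => //; rewrite mem_head.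
  by left.
have mD t : measurable (D t).
  elim: t => [|n t IH]; last by rewrite DS; exact: measurableU.
  have -> : D [::] = F; last by [].
  by apply/seteqP; split=> g; [case=> // -[n]|left].
elim: s => [|n t IH] r0 Fd /=.
  move=> _; rewrite big_nil mulr0 adde0.
  by apply: le_measure; rewrite ?inE//; [exact: mD|move=> g Fg; left].
move=> /andP[nt pt]; rewrite -/(D (n :: t)) DS.
rewrite measureU; last 3 first.
- exact: mI.
- exact: mD.
- apply/seteqP; split=> g //= -[]; rewrite /I /= in_itv /= => gn [Fg|[m mt gm]].
    by apply: (Fd n g (mem_head _ _) Fg).
  have /allP/(_ _ mt) := nt; rewrite /disjoint_balls real_ltNge ?num_real// => /negP; apply.
  by rewrite ler_norml; move: gn gm => /andP[g1 g2] /andP[g3 g4]; apply/andP; split; lra.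
have rn : 0 <= r n by apply: r0; rewrite mem_head.
have muI : lebesgue_measure (I n) = (2 * r n)%:E.
  rewrite lebesgue_measure_itv/= lte_fin; case: ltP => h; last by congr EFin; lra.
  by rewrite -EFinD; congr EFin; lra.
have {}IH : (lebesgue_measure F + (2 * \sum_(n <- t) r n)%:E <= lebesgue_measure (D t))%E.
  apply: IH pt => [m mt|m g mt]; first by apply: r0; rewrite inE mt orbT.
  by apply: Fd; rewrite inE mt orbT.
rewrite big_cons mulrDr EFinD addeCA; apply: leeD; last exact: IH.
by rewrite -muI.
Qed.

(** By the Lebesgue density theorem almost every point of F has density 1 in F,
   which the assumed proportion forbids at every point. *)
Lemma no_density_point_null (R : realType) (F : set R) (k : R) :
  0 < k -> measurable F ->
  (forall x, F x -> exists2 e, 0 < e & forall d, 0 < d -> d < e ->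
     (lebesgue_measure (F `&` ball x d) <= ((1 - k) * (2 * d))%:E)%E) ->
  lebesgue_measure F = 0%E.
Proof.
move=> k0 mF thin; apply/negligibleP; first exact: mF.
apply: negligibleS (lebesgue_density mF) => x Fx /= dens.
have [e e0 eP] := thin x Fx.
suff : ((\1_F x)%:E <= (1 - k)%:E)%E.
  by rewrite indicE mem_set//= lee_fin => h; lra.
rewrite -(cvg_lim _ dens)//; apply: lime_le; first by apply/cvg_ex; eexists; exact: dens.
near=> d; have d0 : 0 < d by [].
have mub : lebesgue_measure (ball x d) = (2 * d)%:E.
  by rewrite lebesgue_measure_ball ?ltW// mulr_natl.
rewrite mub inver gt_eqF ?mulr_gt0//.
apply: (@le_trans _ _ (((1 - k) * (2 * d))%:E * ((2 * d)^-1)%:E)%E).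
  apply: lee_wpmul2r; first by rewrite lee_fin invr_ge0 mulr_ge0// ltW.
  by apply: eP => //; near: d; exact: nbhs_right_lt.
by rewrite -EFinM mulfK// gt_eqF// mulr_gt0.
Unshelve. all: by end_near. Qed.

(** * Badly approximable numbers *)

Section BadCase.
Variables (R : realType) (A : set nat) (a : nat -> nat) (alpha : R) (psi : nat -> R).
Hypotheses (A_pos : A `<=` posnat) (A_enum : increasing_enum A a).
Hypothesis A_density : (0 < lower_density R A)%E.
Hypothesis A_ud : unif_distr_mod1 (fun k : nat => (a k)%:R * alpha).
Hypothesis psiM : calM A psi.

(** The greedy selection is run on the balls centred at 1 - frac (n alpha), for
   n in A, whose centres lie in the middle half of ball x d. Equidistribution
   along A puts a fixed proportion of the centres there, and the selected balls
   then occupy a proportion k of ball x d that far_from avoids. That k depends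
   neither on x and d nor on N0 is what allows the density theorem to apply. *)
Lemma far_from_thin (c : R) : 0 < c ->
  (forall n, (0 < n)%N -> c <= n%:R * dist_int (n%:R * alpha)) ->
  exists2 k : R, 0 < k & forall N0 (x d : R), 0 < d -> d < x -> d < 1 - x ->
    (lebesgue_measure (far_from A psi alpha N0 `&` ball x d)
       <= ((1 - k) * (2 * d))%:E)%E.
Proof.
move=> c0 cP; have [psi0 psia _] := psiM.
have [dl dl0 [Nd dens]] := lower_density_count A_density.
(* The kept radii will add up to tau c / 8 = k d, where tau = d dl / 4: the kept
   balls fill a proportion k of a ball of radius d. *)
exists (dl * c / 32) => [|N0 x d d0 dx d1x]; first by rewrite divr_gt0// mulr_gt0.
(* dl L >= 16 makes the centres of index at most M few with respect to those of
   index in ]M, L M]. *)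
pose L := maxn 2 (Num.truncn (16 / dl)).+1.
have L1 : (1 < L)%N by rewrite /L leq_maxl.
have dL : 16 <= dl * L%:R.
  rewrite mulrC -ler_pdivrMr// ltW//; apply: (lt_le_trans (truncnS_gt _)).
  by rewrite ler_nat leq_maxr.
have L0 : (0 < L)%N by exact: ltnW.
have Lr : 0 < L%:R :> R by rewrite ltr0n.
clearbody L.
pose eta := c / (4 * L%:R).
have eta0 : 0 < eta by rewrite divr_gt0// mulr_gt0.
pose r n := Num.min (psi n) (eta / n%:R).
pose y n := 1 - frac_part (n%:R * alpha).
pose s := 1 - x - d / 2; pose t := 1 - x + d / 2.
pose P n := (n \in A) && (s <= frac_part (n%:R * alpha) < t).
have e0 : 0 < d / 2 by lra.
have [N1 N1P] : exists N1, forall N, (N1 <= N)%N ->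
    `|(count P (iota 1 N))%:R - d * (count (fun n => n \in A) (iota 1 N))%:R|
      <= d / 2 * (count (fun n => n \in A) (iota 1 N))%:R.
  have s0 : 0 <= s by rewrite /s; lra.
  have st : s < t by rewrite /s /t; lra.
  have t1 : t <= 1 by rewrite /t; lra.
  have [N1 h] := equidistributed_count A_pos A_enum A_density A_ud s0 st t1 e0.
  exists N1 => N /h; suff -> : t - s = d by [].
  by rewrite /s /t; lra.
(* From N2 on the radii are at most d / 4, so the balls centred in the middle
   half of ball x d stay in it. *)
pose N2 := maxn N0 (Num.truncn (eta / (d / 4))).+1.
pose C n := (N2 <= n)%N && P n.
have r_small n : (0 < n)%N -> r n <= eta / n%:R by move=> n0; rewrite ge_min lexx orbT.
have r_le_psi n : r n <= psi n by rewrite ge_min lexx.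
have r_ge0 n : (0 < n)%N -> 0 <= r n.
  by move=> n0; rewrite le_min psi0// divr_ge0// ltW.
have r_anti m n : (0 < m)%N -> (m <= n)%N -> r n <= r m.
  move=> m0 mn; rewrite /r le_min !ge_min psia//= ler_pM2l// lef_pV2 ?posrE ?ltr0n//.
    by rewrite ler_nat mn orbT.
  exact: leq_trans mn.
have rd n : (N2 <= n)%N -> r n <= d / 4.
  rewrite geq_max => /andP[_ nN]; have n0 : (0 < n)%N by exact: leq_trans nN.
  apply: (le_trans (r_small _ n0)); rewrite ler_pdivrMr ?ltr0n// mulrC -ler_pdivrMr; last lra.
  by rewrite ltW//; apply: (lt_le_trans (truncnS_gt _)); rewrite ler_nat.
have C_pos n : C n -> (0 < n)%N by rewrite /C geq_max => /andP[/andP[_ h] _]; exact: leq_trans h.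
have y_sep m n N : m != n -> (m <= N)%N -> (n <= N)%N -> c / N%:R <= `|y m - y n|.
  move=> mn mN nN; have := frac_part_separated c0 cP mn mN nN.
  by rewrite distrC /y; congr (_ <= `|_|); ring.
have cntP N : (maxn N1 Nd <= N)%N ->
    d / 2 * dl * N%:R <= (count P (iota 1 N))%:R <= 3 / 2 * d * N%:R.
  rewrite geq_max => /andP[/N1P + /dens].
  have : (count (fun n => n \in A) (iota 1 N))%:R <= N%:R :> R.
    by rewrite ler_nat (leq_trans (count_size _ _))// size_iota.
  set p := (count _ _)%:R; set q := (count P _)%:R => pN + dp.
  rewrite ler_norml => /andP[h1 h2].
  have : d / 2 * (dl * N%:R) <= d / 2 * p by rewrite ler_pM2l.
  have : d * p <= d * N%:R by rewrite ler_pM2l.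
  by move=> h3 h4; apply/andP; split; lra.
have many M : (maxn N2 (maxn N1 Nd) <= M)%N -> d * dl / 4 * (L * M)%:R <=
     (count C (iota M.+1 (L * M - M)))%:R - (count C (iota 1 M))%:R.
  rewrite geq_max => /andP[N2M NM].
  have MLM : (M <= L * M)%N by rewrite leq_pmull.
  have /andP[h1 _] := cntP _ (leq_trans NM MLM).
  have /andP[_ h2] := cntP _ NM.
  have h3 : (count C (iota 1 M))%:R <= (count P (iota 1 M))%:R :> R.
    by rewrite ler_nat; apply: sub_count => n /andP[].
  have h4 : (count P (iota 1 (L * M)))%:R =
      (count P (iota 1 M))%:R + (count C (iota M.+1 (L * M - M)))%:R :> R.
    rewrite -[in LHS](subnKC MLM) iotaD count_cat natrD add1n; congr (_ + _%:R).
    apply: eq_in_count => n; rewrite mem_iota => /andP[Mn _].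
    by rewrite /C (leq_trans N2M (ltnW Mn)).
  have h6 : 0 <= d * M%:R by rewrite mulr_ge0// ltW.
  have h5 : 16 * (d * M%:R) <= dl * L%:R * (d * M%:R) by rewrite ler_wpM2r.
  move: h1; rewrite natrM => h1; rewrite {}h4 in h1; lra.
have dv := dyadic_truncation_diverges A_pos psiM eta0 L1.
have tau0 : 0 < d * dl / 4 by rewrite divr_gt0// mulr_gt0.
have [N large] := greedy_sum_large c0 L0 C_pos r_ge0 r_anti r_small y_sep L1 tau0 many dv.
have mF : measurable (far_from A psi alpha N0 `&` ball x d).
  by apply: measurableI; [exact: measurable_far_from|exact: measurable_ball].
have sel n : n \in greedy C y r N -> C n by rewrite mem_greedy => /andP[_ /andP[]].
have avoid n g : n \in greedy C y r N ->
    (far_from A psi alpha N0 `&` ball x d) g -> ~ (y n - r n <= g <= y n + r n).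
  move=> /sel /andP[N2n /andP[+ _]] [gfar _] /andP[g1 g2]; rewrite inE => An.
  have N0n : (N0 <= n)%N by apply: leq_trans N2n; exact: leq_maxl.
  have := gfar n An N0n; apply/negP; rewrite -leNgt; apply: le_trans (r_le_psi n).
  apply: (le_trans (dist_int_le _ (Num.floor (n%:R * alpha) + 1))).
  rewrite intrD ler_norml; move: g1 g2; rewrite /y /frac_part => g1 g2.
  by apply/andP; split; lra.
have := measure_disjoint_balls mF (fun n h => r_ge0 n (C_pos n (sel n h))) avoid
  (greedy_pairwise C y r N).
set U := (X in (_ <= lebesgue_measure X)%E -> _) => hU.
have Ux : U `<=` ball x d.
  move=> g [[]//|[n /sel /andP[N2n /andP[_ /andP[f1 f2]]] /andP[g1 g2]]].
  have rn := rd n N2n; rewrite -ball_normE /= ltr_norml.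
  move: g1 g2 f1 f2; rewrite /y /s /t => g1 g2 f1 f2.
  by apply/andP; split; lra.
have muU : (lebesgue_measure U <= (2 * d)%:E)%E.
  apply: (@le_trans _ _ (lebesgue_measure (ball x d))); first exact: le_outer_measure.
  by rewrite (lebesgue_measure_ball x (ltW d0)) mulr_natl.
have := le_trans hU muU; rewrite -leeBrDr// => /le_trans; apply.
by rewrite -EFinB lee_fin; lra.
Qed.

Lemma bad_full_measure :
  (0 < limn_einf (fun n : nat => (n%:R * dist_int (n%:R * alpha))%:E))%E ->
  lebesgue_measure (calT A psi alpha) = 1%E.
Proof.
move=> /bad_uniform[c c0 cP]; have [k k0 thin] := far_from_thin c0 cP.
pose F N := far_from A psi alpha N `&` `]0, 1[%classic.
have mF N : measurable (F N).
  by apply: measurableI; [exact: measurable_far_from|exact: measurable_itv].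
have F0 N : lebesgue_measure (F N) = 0%E.
  apply: (no_density_point_null k0 (mF N)) => x [_ /=].
  rewrite in_itv /= => /andP[x0 x1]; exists (Num.min x (1 - x)).
    by rewrite lt_min x0 subr_gt0.
  move=> d d0; rewrite lt_min => /andP[dx d1x]; apply: le_trans (thin N x d d0 dx d1x).
  by apply: le_outer_measure; apply: setSI => g [].
have FU0 : (lebesgue_measure (\bigcup_N F N) <= 0)%E.
  suff -> : lebesgue_measure (\bigcup_N F N) = 0%E by [].
  apply/negligibleP; first by apply: bigcup_measurable => N _; exact: mF.
  by apply: negligible_bigcup => N; apply/negligibleP; [exact: mF|exact: F0].
have mT : measurable (calT A psi alpha).
  rewrite calT_far_from; apply: measurableD.
    rewrite (_ : [set g | 0 <= g < 1] = `[0, 1[%classic); first exact: measurable_itv.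
    by apply/seteqP; split=> g /=; rewrite in_itv.
  by apply: bigcup_measurable => N _; exact: measurable_far_from.
have mu01 : lebesgue_measure (`]0, 1[%classic : set R) = 1%E.
  by rewrite lebesgue_measure_itv/= lte_fin ltr01 -EFinB subr0.
apply/eqP; rewrite eq_le; apply/andP; split.
  apply: (@le_trans _ _ (lebesgue_measure (`[0, 1[%classic : set R))).
    by apply: le_outer_measure => g [h _]; rewrite /= in_itv.
  by rewrite lebesgue_measure_itv/= lte_fin ltr01 -EFinB subr0.
rewrite -mu01; apply: (@le_trans _ _
    (lebesgue_measure (calT A psi alpha `|` \bigcup_N F N))).
  apply: le_outer_measure => g /=; rewrite in_itv /= => /andP[g0 g1].
  have [[N _ gN]|nF] := pselect ((\bigcup_N far_from A psi alpha N) g).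
    by right; exists N => //; split=> //=; rewrite in_itv /= g0.
  by left; rewrite calT_far_from; split=> //=; rewrite ltW.
apply: (le_trans (measureU2 _ _ _)); [exact: mT| |].
  by apply: bigcup_measurable => N _; exact: mF.
by rewrite -[leRHS]adde0; apply: leeD; [exact: lexx|exact: FU0].
Qed.

End BadCase.

Theorem theorem6 (R : realType) (A : set nat) (a : nat -> nat)
  (A_pos : A `<=` posnat)
  (A_infinite : infinite_set A)
  (A_enum : increasing_enum A a)
  (A_density : (0 < lower_density R A)%E)
  (A_ud : forall alpha : R, BAD R alpha ->
     unif_distr_mod1 (fun k : nat => (a k)%:R * alpha)) :
  \bigcap_(psi in calM A) calK A psi = BAD R.
Proof.
apply/seteqP; split=> alpha.
  move=> inK; split.
    (* The number 0 is not badly approximable, so it provides one psi in calM;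
       that is enough to place alpha in [0, 1). *)
    have [|psi [psiM _]] := @not_bad_witness R A A_pos A_density 0.
      move=> /limn_einf_gt0P[c c0 [N /(_ N (leqnn N))]].
      have -> : dist_int (N%:R * 0 : R) = 0.
        apply/eqP; rewrite eq_le dist_int_ge0 andbT mulr0.
        by rewrite (le_trans (dist_int_le_norm _))// normr0.
      by rewrite mulr0 leNgt c0.
    by have [] := inK psi psiM.
  apply: contrapT => not_bad.
  have [psi [psiM]] := not_bad_witness A_pos A_density not_bad.
  by have [_ ->] := inK psi psiM; rewrite ltxx.
move=> bad psi psiM; have [alpha01 liminf0] := bad; split=> //.
exact: bad_full_measure A_pos A_enum A_density (A_ud _ bad) psiM liminf0.
Qed.
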